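(* Let $0\le \nu\le 1$, $M>0$, $D>0$ and $n\ge 4$. There exists an instance of the problem $p^*:=\min_{y\in\mathcal{Y}} f(y)$, where $\mathcal{Y}\subseteq\mathbb{R}^n$ is a nonempty convex compact set with diameter $\sup_{y,y'\in\mathcal{Y}}\|y-y'\|=D$ and $f:\mathbb{R}^n\to\mathbb{R}$ is convex and $(M,\nu)$-Hölder smooth, such that for any LMO-based active-hull method with at most $K$ LMO calls, its output $\bar y_K$ satisfies $$f(\bar y_K)-p^*\ \ge\ C_\nu\, M D^{1+\nu}(K+1)^{-\frac{1+\nu}{2}},\qquad \forall\, 1\le K\le \lfloor n/2\rfloor-1,$$ where $C_\nu>0$ is some constant that only depends on $\nu$. In other words, for any LMO-based active-hull method to output an $\varepsilon$-optimal solution of this problem (i.e., a point $y\in\mathcal{Y}$ with $f(y)-p^*<\varepsilon$, where $\varepsilon>0$), the number of LMO calls has to be at least $$\left\lceil \min\left\{\lfloor n/2\rfloor,\ C_\nu^{\frac{2}{1+\nu}}M^{\frac{2}{1+\nu}}D^2\varepsilon^{-\frac{2}{1+\nu}}\right\}\right\rceil-1 .$$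
   Context: $\|\cdot\|$ is the Euclidean norm. A convex function $f:\mathbb{R}^n\to\mathbb{R}$ is $(M,\nu)$-Hölder smooth if $0\le f(x)-f(z)-\langle s_z,x-z\rangle\le \frac{M}{1+\nu}\|x-z\|^{1+\nu}$ for all $x,z\in\mathbb{R}^n$ and all subgradients $s_z\in\partial f(z)$. A linear minimization oracle (LMO) of $\mathcal{Y}$ is an oracle that, given $\lambda\in\mathbb{R}^n$, outputs a solution of $\min_{y\in\mathcal{Y}}\langle\lambda,y\rangle$. An LMO-based active-hull method takes as input a point $y_0\in\mathcal{Y}$, a total number of iterations $K\ge 1$ and problem parameters (e.g., $M,\nu,D$). For $k=0,1,\dots,K-1$ it constructs a vector $\lambda_k\in\mathbb{R}^n$ (in any way, e.g. using various oracles of $f$) and calls the LMO to compute $y_{k+1}\in\arg\min_{y\in\mathcal{Y}}\langle\lambda_k,y\rangle$. It then outputs a point $\bar y_K\in\mathrm{conv}\{y_0,\dots,y_K\}$.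
   Formalization: The starting point y_0 and the LMO (a fixed selection of minimizers, including its tie-breaking) are chosen as part of the instance; the bound fails if y_0 may be a minimizer of f, or if the LMO may return one when λ=0. *)

(* Defs.v *)
From HB Require Import structures.
From mathcomp Require Export all_boot all_order all_algebra.
From mathcomp Require Export all_classical all_reals all_analysis.

Set Implicit Arguments.
Unset Strict Implicit.
Unset Printing Implicit Defensive.

Export Order.TTheory GRing.Theory Num.Theory.
Export numFieldNormedType.Exports.

Local Open Scope classical_set_scope.
Local Open Scope ring_scope.

Section Euclidean.
Variables (R : realType) (n : nat).
Implicit Types (x y z u v s : 'rV[R]_n) (Y : set 'rV[R]_n) (f : 'rV[R]_n -> R).

Definition dotv u v : R := \sum_(i < n) u ord0 i * v ord0 i.

(* The library norm on matrices is the sup norm. It induces the same topology,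
   so the library's [compact] can be used on 'rV[R]_n. *)
Definition enorm x : R := Num.sqrt (dotv x x).

(* [sup] is the supremum only for a nonempty bounded set, hence for a nonempty
   compact Y; otherwise it is 0. *)
Definition diameter Y : R :=
  sup [set r | exists y y', [/\ Y y, Y y' & r = enorm (y - y')]].

Definition subdifferential f z : set 'rV[R]_n :=
  [set s | forall x, f z + dotv s (x - z) <= f x].

Definition holder_smooth (M nu : R) f : Prop :=
  forall x z s, subdifferential f z s ->
    0 <= f x - f z - dotv s (x - z) <=
      M / (1 + nu) * enorm (x - z) `^ (1 + nu).

Definition is_min_value Y f (p : R) : Prop :=
  (exists2 y, Y y & f y = p) /\ (forall y, Y y -> p <= f y).

Definition eps_optimal Y f (p eps : R) y : Prop := Y y /\ f y - p < eps.

(* An oracle is a fixed single-valued selection of minimizers, so its tie-breaking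
   (e.g. at lambda = 0, where every point of Y is a valid answer) belongs to the
   problem instance and is not chosen by the method. *)
Definition is_lmo Y (lmo : 'rV[R]_n -> 'rV[R]_n) : Prop :=
  forall lambda, Y (lmo lambda) /\
    (forall y, Y y -> dotv lambda (lmo lambda) <= dotv lambda y).

Definition conv_hull_seq (h : seq 'rV[R]_n) : set 'rV[R]_n :=
  [set y | exists w : 'I_(size h) -> R,
    [/\ forall i, 0 <= w i, \sum_i w i = 1 & y = \sum_i w i *: h`_i]].

(* [ah_direction m K [:: y_0; ...; y_k]] is lambda_k and
   [ah_output m K [:: y_0; ...; y_K]] is the output, where K is the total number
   of iterations. The objective f and the problem parameters are not explicit
   arguments: the lower bound quantifies over methods once the instance is
   fixed, so both functions may depend on all of its data. *)
Record active_hull_method := ActiveHullMethod {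
  ah_direction : nat -> seq 'rV[R]_n -> 'rV[R]_n ;
  ah_output : nat -> seq 'rV[R]_n -> 'rV[R]_n ;
  ah_output_hull : forall K h, size h = K.+1 -> conv_hull_seq h (ah_output K h)
}.

Fixpoint ah_iterates (m : active_hull_method) (lmo : 'rV[R]_n -> 'rV[R]_n)
    (y0 : 'rV[R]_n) (K k : nat) : seq 'rV[R]_n :=
  if k is k'.+1 then
    let h := ah_iterates m lmo y0 K k' in rcons h (lmo (ah_direction m K h))
  else [:: y0].

(* This run makes exactly K calls to [lmo]. *)
Definition ah_run (m : active_hull_method) (lmo : 'rV[R]_n -> 'rV[R]_n)
    (y0 : 'rV[R]_n) (K : nat) : 'rV[R]_n :=
  ah_output m K (ah_iterates m lmo y0 K K).

End Euclidean.

(* Main.v *)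
(* The feasible set is the simplex spanned by the vectors d e_i with
   d = D / sqrt 2, the objective is M / (2 (1 + nu)) |x|^(1 + nu), and the oracle
   always answers with a vertex. After N calls the output y is a convex
   combination of at most N + 1 vertices, so it has at most N + 1 nonzero
   coordinates; they sum to d, hence |y|^2 >= d^2 / (N + 1) by Cauchy-Schwarz,
   while the barycenter attains the minimum |x|^2 = d^2 / n. As n >= 2 (N + 1),
   the gap is a constant fraction of d^(1 + nu) (N + 1)^(-(1 + nu) / 2). *)
Require Import Defs.
From mathcomp Require Import all_boot all_order all_algebra.
From mathcomp Require Import all_classical all_reals all_analysis.
From mathcomp Require Import ring lra.

Set Implicit Arguments.
Unset Strict Implicit.
Unset Printing Implicit Defensive.

Local Open Scope classical_set_scope.
Local Open Scope ring_scope.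

(** * Subadditivity and midpoint concavity of [t^q] for [0 < q <= 1] *)

Section PowerInequalities.
Variable R : realType.
Implicit Types a b p q : R.

(** The fractions [a / (a + b)] and [b / (a + b)] lie in [0, 1], so each is at most its [q]-th
    power, and they sum to 1. *)
Lemma powR_subadd q a b : 0 < q <= 1 -> 0 <= a -> 0 <= b ->
  (a + b) `^ q <= a `^ q + b `^ q.
Proof.
move=> /andP[q0 q1] a0 b0; have [ab0|ab0] := eqVneq (a + b) 0.
  by rewrite ab0 powR0 ?gt_eqF// addr_ge0 ?powR_ge0.
have abp : 0 < a + b by rewrite lt_neqAle eq_sym ab0 addr_ge0.
have frac c : 0 <= c -> c <= a + b -> c / (a + b) * (a + b) `^ q <= c `^ q.
  move=> c0 cab.
  have [->|cn0] := eqVneq c 0; first by rewrite !mul0r powR_ge0.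
  have cp : 0 < c by rewrite lt_neqAle eq_sym cn0.
  have c1 : 0 < c / (a + b) <= 1 by rewrite divr_gt0//= ler_pdivrMr ?mul1r.
  rewrite -{2}(divfK ab0 c) powRM ?divr_ge0 ?(ltW abp)//.
  by rewrite ler_wpM2r ?powR_ge0// -{1}(powRr1 (ltW (andP c1).1)) ger_powR.
have := lerD (frac a a0 _) (frac b b0 _).
by rewrite -mulrDl -mulrDl divff// mul1r lerDl lerDr; exact.
Qed.

(** Concavity is read off from convexity of [t^(1/q)] at the points [a^q] and [b^q]. *)
Lemma powR_midpoint q a b : 0 < q <= 1 -> 0 <= a -> 0 <= b ->
  a `^ q + b `^ q <= 2 * ((a + b) / 2) `^ q.
Proof.
move=> /andP[q0 q1] a0 b0.
have half01 : 0 <= (2^-1 : R) <= 1 by rewrite invr_ge0 ler0n invf_le1 ?ler1n.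
have pos c : c `^ q \in (`[0, +oo[%classic : set R).
  by rewrite inE/= in_itv/= andbT powR_ge0.
have q1' : 1 <= q^-1 by rewrite invf_ge1.
have := convex_powR q1' (Itv01 (andP half01).1 (andP half01).2) (pos a) (pos b).
rewrite !convRE /= /unstable.onem -!powRrM divff ?gt_eqF// !powRr1// => h.
have h0 : 0 <= 2^-1 * a `^ q + (1 - 2^-1) * b `^ q.
  by have := powR_ge0 a q; have := powR_ge0 b q; lra.
have h1 : 0 <= (a + b) / 2 by lra.
have h2 : 2^-1 * a `^ q + (1 - 2^-1) * b `^ q <= ((a + b) / 2) `^ q.
  rewrite -[leLHS]powRr1// -[X in _ `^ X <= _](mulVf (lt0r_neq0 q0)) powRrM.
  apply: ge0_ler_powR; rewrite ?nnegrE ?powR_ge0 ?(ltW q0)//.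
  by apply: le_trans h _; lra.
by lra.
Qed.

End PowerInequalities.

(** * Euclidean inner product, convexity and smoothness of powers of the norm *)

Section EuclideanNorm.
Variables (R : realType) (n : nat).
Implicit Types x y z h : 'rV[R]_n.

Lemma dotvC x y : dotv x y = dotv y x.
Proof. by apply: eq_bigr => i _; rewrite mulrC. Qed.

Lemma dotvDl x y z : dotv (x + y) z = dotv x z + dotv y z.
Proof. by rewrite -big_split; apply: eq_bigr => i _; rewrite mxE mulrDl. Qed.

Lemma dotvZl a x y : dotv (a *: x) y = a * dotv x y.
Proof. by rewrite mulr_sumr; apply: eq_bigr => i _; rewrite mxE mulrA. Qed.

Lemma dotvNl x y : dotv (- x) y = - dotv x y.
Proof. by rewrite -scaleN1r dotvZl mulN1r. Qed.

Lemma dotvDr x y z : dotv x (y + z) = dotv x y + dotv x z.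
Proof. by rewrite dotvC dotvDl !(dotvC x). Qed.

Lemma dotvZr a x y : dotv x (a *: y) = a * dotv x y.
Proof. by rewrite dotvC dotvZl (dotvC x). Qed.

Lemma dotvNr x y : dotv x (- y) = - dotv x y.
Proof. by rewrite dotvC dotvNl (dotvC x). Qed.

Lemma dotvv_ge0 x : 0 <= dotv x x.
Proof. by apply: sumr_ge0 => i _; rewrite -expr2 sqr_ge0. Qed.

Lemma enorm_ge0 x : 0 <= enorm x. Proof. exact: sqrtr_ge0. Qed.

Lemma enorm_sqr x : enorm x ^+ 2 = dotv x x.
Proof. exact/sqr_sqrtr/dotvv_ge0. Qed.

Lemma enorm_powR p x : enorm x `^ p = dotv x x `^ (p / 2).
Proof.
by rewrite /enorm -powR12_sqrt ?dotvv_ge0// -powRrM; congr (_ `^ _); field.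
Qed.

Lemma dotv_eq0 x y : dotv x x = 0 -> dotv x y = 0.
Proof.
move=> /eqP; rewrite psumr_eq0 => [/allP x0|i _]; last by rewrite -expr2 sqr_ge0.
apply: big1 => i _; have := x0 i (mem_index_enum _).
by rewrite -expr2 sqrf_eq0 => /eqP->; rewrite mul0r.
Qed.

(** Cauchy-Schwarz, by expanding the squared norm of [enorm y *: x - enorm x *: y]; zero norms are
    treated apart because the expansion is divided by [enorm x * enorm y]. *)
Lemma dotv_le x y : dotv x y <= enorm x * enorm y.
Proof.
have [x0|x0] := eqVneq (enorm x) 0.
  by rewrite x0 mul0r dotv_eq0// -enorm_sqr x0 expr0n.
have [y0|y0] := eqVneq (enorm y) 0.
  by rewrite y0 mulr0 dotvC dotv_eq0// -enorm_sqr y0 expr0n.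
have xy : 0 < enorm x * enorm y.
  by rewrite mulr_gt0// lt_neqAle eq_sym enorm_ge0 ?x0 ?y0.
rewrite -(ler_pM2l xy); have := dotvv_ge0 (enorm y *: x - enorm x *: y).
rewrite !(dotvDl, dotvDr, dotvNl, dotvNr, dotvZl, dotvZr) -!enorm_sqr (dotvC y x); nra.
Qed.

Lemma enormD x y : enorm (x + y) <= enorm x + enorm y.
Proof.
rewrite -(ler_pXn2r (_ : (0 < 2)%N)) ?nnegrE ?addr_ge0 ?enorm_ge0//.
rewrite enorm_sqr !(dotvDl, dotvDr) sqrrD -!enorm_sqr (dotvC y x).
by have := dotv_le x y; lra.
Qed.

Lemma enormZ a x : 0 <= a -> enorm (a *: x) = a * enorm x.
Proof.
move=> a0; rewrite /enorm dotvZl dotvZr mulrA -expr2 sqrtrM ?sqr_ge0//.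
by rewrite sqrtr_sqr ger0_norm.
Qed.

(** The triangle inequality makes the norm convex, and [t^p] is convex and nondecreasing on the
    nonnegative reals. *)
Lemma convex_enorm_powR p : 1 <= p ->
  convex_function setT (fun x : convex_lmodType 'rV[R]_n => enorm x `^ p : R^o).
Proof.
move=> p1 t x y _ _.
have t1 : 0 <= 1 - t%:num by rewrite subr_ge0.
have pos z : enorm z \in (`[0, +oo[%classic : set R).
  by rewrite inE/= in_itv/= andbT enorm_ge0.
apply: (@le_trans _ _ ((t%:num * enorm x + (1 - t%:num) * enorm y) `^ p)); last first.
  by have := convex_powR p1 t (pos x) (pos y); rewrite !convRE.
apply: ge0_ler_powR; rewrite ?nnegrE ?enorm_ge0 ?(le_trans ler01 p1)//.
  by rewrite addr_ge0// mulr_ge0 ?enorm_ge0.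
by apply: le_trans (enormD _ _) _; rewrite !enormZ.
Qed.

(* Parallelogram identity, then midpoint concavity and subadditivity of
   t |-> t^(p/2). *)
Lemma enorm_powR_second_difference p z h : 1 <= p -> p <= 2 ->
  enorm (z + h) `^ p + enorm (z - h) `^ p <=
  2 * enorm z `^ p + 2 * enorm h `^ p.
Proof.
move=> p1 p2; have q01 : 0 < p / 2 <= 1 by lra.
rewrite !enorm_powR.
apply: le_trans (powR_midpoint q01 (dotvv_ge0 _) (dotvv_ge0 _)) _.
rewrite -mulrDr ler_pM2l//;
apply: le_trans (powR_subadd q01 (dotvv_ge0 z) (dotvv_ge0 h)).
by rewrite !(dotvDl, dotvDr, dotvNl, dotvNr); set a := (X in X `^ _);
   rewrite (_ : a = dotv z z + dotv h h) // /a; field.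
Qed.

(* Testing the subgradient inequality at 2z - x bounds the linearization
   error at x by a second difference, so no derivative of the norm is needed. *)
Lemma enorm_powR_linearization (p c : R) x z s : 1 <= p -> p <= 2 -> 0 <= c ->
  subdifferential (fun y : 'rV[R]_n => c * enorm y `^ p) z s ->
  0 <= c * enorm x `^ p - c * enorm z `^ p - dotv s (x - z) <=
    2 * c * enorm (x - z) `^ p.
Proof.
move=> p1 p2 c0 sz; apply/andP; split.
  by rewrite -addrA -opprD subr_ge0; exact: sz.
have arith (a b d e k : R) :
  b - d <= e -> a + e <= 2 * b + 2 * k -> a - b - d <= 2 * k by lra.
have := sz (z - (x - z)); rewrite addrAC subrr sub0r dotvNr -mulrA.
move=> /arith; apply; rewrite -!(mulrCA c 2) -!mulrDr; apply: ler_wpM2l => //.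
rewrite mulrDr.
by have := enorm_powR_second_difference z (x - z) p1 p2;
   rewrite (addrC z (x - z)) subrK.
Qed.

(** The linearization bound costs a factor 2, absorbed by the 2 in the denominator of the
    objective's coefficient. *)
Lemma holder_smooth_enorm_powR (M nu : R) : 0 <= nu -> nu <= 1 -> 0 <= M ->
  holder_smooth M nu
    (fun x : 'rV[R]_n => M / (2 * (1 + nu)) * enorm x `^ (1 + nu)).
Proof.
move=> nu0 nu1 M0 x z s sz.
have -> : M / (1 + nu) = 2 * (M / (2 * (1 + nu))).
  by rewrite invfM mulrCA mulVKf// pnatr_eq0.
apply: enorm_powR_linearization sz.
- by rewrite lerDl.
- by rewrite -[2]/(1 + 1) lerD2l.
- by rewrite divr_ge0// mulr_ge0// addr_ge0.
Qed.

End EuclideanNorm.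

(** * Geometry of the scaled simplex and sparsity of hulls of few vertices *)

Section ScaledSimplex.
Variables (R : realType) (n : nat).
Implicit Types (d : R) (x y : 'rV[R]_n) (i j : 'I_n) (s : seq 'I_n).

Definition simplex d : set 'rV[R]_n :=
  [set y | (forall i, 0 <= y ord0 i) /\ \sum_i y ord0 i = d].

Definition vertex d i : 'rV[R]_n := d *: delta_mx ord0 i.

Lemma vertexE d i j : vertex d i ord0 j = d * (j == i)%:R.
Proof. by rewrite !mxE eqxx. Qed.

Lemma sum_delta (F : 'I_n -> R) i : \sum_j F j * (j == i)%:R = F i.
Proof.
rewrite (bigD1 i)//= eqxx mulr1 big1 ?addr0// => j /negPf->.
by rewrite mulr0.
Qed.

Lemma dotv_vertex d x i : dotv x (vertex d i) = d * x ord0 i.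
Proof.
rewrite -(sum_delta (fun j => d * x ord0 j)); apply: eq_bigr => j _.
by rewrite vertexE mulrA (mulrC d).
Qed.

Lemma simplex_vertex d i : 0 <= d -> simplex d (vertex d i).
Proof.
move=> d0; split=> [j|]; first by rewrite vertexE mulr_ge0.
by rewrite -[RHS](sum_delta (fun=> d) i); apply: eq_bigr => j _; rewrite vertexE.
Qed.

Lemma simplex_le d y i : simplex d y -> y ord0 i <= d.
Proof.
move=> [y0 <-]; rewrite (bigD1 i)//= lerDl.
by apply: sumr_ge0 => j _; exact: y0.
Qed.

Lemma convex_simplex d : convex_set (simplex d).
Proof.
move=> x y t; rewrite !inE => -[x0 xd] [y0 yd].
have t1 : 0 <= 1 - t%:num by rewrite subr_ge0.
split=> [i|]; first by rewrite !mxE addr_ge0// mulr_ge0.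
under eq_bigr => i _ do rewrite !mxE.
by rewrite big_split/= -!mulr_sumr xd yd -mulrDl addrC subrK mul1r.
Qed.

(** A box, compact as a product of segments, is cut by the closed hyperplane of coordinate sum
    [d]. *)
Lemma compact_simplex d : compact (simplex d).
Proof.
have -> : simplex d =
    [set v : 'rV[R]_n | forall i, [set` `[0, d]%R] (v ord0 i)] `&`
    (fun v : 'rV[R]_n => \sum_i v ord0 i) @^-1` [set r | r = d].
  apply/seteqP; split=> y /=.
    move=> yd; split; last exact: yd.2.
    by move=> i; rewrite in_itv/= yd.1 (simplex_le i yd).
  by move=> [y0 yd]; split=> // i; have := y0 i; rewrite in_itv/= => /andP[].
apply: compact_closedI.
  by apply: (@rV_compact _ _ (fun=> [set` `[0, d]%R])) => _; exact: segment_compact.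
apply: preimage_closed (@closed_eq _ _) => v _.
by apply: continuous_big => [|i _]; [exact: add_continuous|exact: coord_continuous].
Qed.

Lemma dotvv_simplex_le d y : simplex d y -> dotv y y <= d ^+ 2.
Proof.
move=> yd; have [y0 ysum] := yd.
rewrite expr2 -{2}ysum mulr_sumr; apply: ler_sum => i _.
by rewrite ler_wpM2r// simplex_le.
Qed.

(** Nonnegative coordinates give [dotv y y' >= 0], so the squared distance is at most [2 d^2]; two
    distinct vertices attain it. *)
Lemma diameter_simplex d i j : 0 <= d -> i != j ->
  diameter (simplex d) = Num.sqrt 2 * d.
Proof.
move=> d0 ij; rewrite /diameter; set E := (X in sup X).
have ubE : ubound E (Num.sqrt 2 * d).
  move=> _ [y [y' [yd y'd ->]]].
  rewrite -(ger0_norm d0) -sqrtr_sqr -sqrtrM// ler_wsqrtr//.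
  have yy' : 0 <= dotv y y'.
    by apply: sumr_ge0 => k _; rewrite mulr_ge0// ?yd.1 ?y'd.1.
  rewrite !(dotvDl, dotvDr, dotvNl, dotvNr) (dotvC y' y).
  have := dotvv_simplex_le yd; have := dotvv_simplex_le y'd.
  by move: yy'; move: (dotv y y) (dotv y y') (dotv y' y') => a b c; clear; lra.
have mE : E (Num.sqrt 2 * d).
  exists (vertex d i), (vertex d j); split; [exact: simplex_vertex..|].
  rewrite -{1}(ger0_norm d0) -sqrtr_sqr -sqrtrM//; congr Num.sqrt.
  rewrite !(dotvDl, dotvDr, dotvNl, dotvNr) !dotv_vertex !vertexE !eqxx (negPf ij).
  by rewrite eq_sym (negPf ij) expr2 !mulr1n !mulr0n; ring.
apply/eqP; rewrite eq_le; apply/andP; split;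
  first by apply: ge_sup => //; exists (Num.sqrt 2 * d).
by apply: ub_le_sup => //; exists (Num.sqrt 2 * d).
Qed.

(** Cauchy-Schwarz against the indicator vector [v] of [S]. *)
Lemma sqr_sum_le_dotvv (S : {set 'I_n}) y :
  (forall i, i \notin S -> y ord0 i = 0) ->
  (\sum_i y ord0 i) ^+ 2 <= #|S|%:R * dotv y y.
Proof.
move=> yS; set v : 'rV[R]_n := \row_i (i \in S)%:R.
have vy : dotv v y = \sum_i y ord0 i.
  apply: eq_bigr => i _; rewrite mxE.
  by case: (boolP (i \in S)) => [_|/yS ->]; rewrite ?mul1r ?mulr0.
have vv : dotv v v = #|S|%:R.
  rewrite -sum1_card natr_sum big_mkcond/=; apply: eq_bigr => i _; rewrite mxE.
  by case: (i \in S); rewrite ?mulr1 ?mulr0.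
(* Squares are compared through absolute values, so Cauchy-Schwarz is used for both [v] and
   [- v]. *)
rewrite -vy -vv -!enorm_sqr -exprMn -[leLHS]real_normK ?num_real//.
rewrite ler_sqr ?nnegrE ?mulr_ge0 ?enorm_ge0// ler_norml dotv_le andbT.
have := dotv_le (- v) y; rewrite dotvNl lerNl.
by rewrite /enorm dotvNl dotvNr opprK.
Qed.

(** The support of [y] lies in the set of indices occurring in [s]; repetitions only shrink that
    set, so its cardinality is at most [size s]. *)
Lemma conv_hull_vertices d s y : 0 <= d ->
  conv_hull_seq [seq vertex d i | i <- s] y ->
  simplex d y /\ d ^+ 2 <= (size s)%:R * dotv y y.
Proof.
move=> d0 [w [w0 w1 yE]].
have hyp (k : 'I_(size [seq vertex d i | i <- s])) :
    exists2 i, i \in s & [seq vertex d i | i <- s]`_k = vertex d i.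
  by have /mapP[i si ->] := mem_nth 0 (ltn_ord k); exists i.
have ysimplex : simplex d y.
  split=> [i|].
    rewrite yE summxE; apply: sumr_ge0 => k _; rewrite mxE mulr_ge0//.
    by have [j _ ->] := hyp k; exact: (simplex_vertex j d0).1.
  rewrite yE; under eq_bigr => i _ do rewrite summxE.
  rewrite exchange_big/= -[RHS]mul1r -w1 mulr_suml; apply: eq_bigr => k _.
  have [j _ ->] := hyp k; under eq_bigr => i _ do rewrite mxE.
  by rewrite -mulr_sumr (simplex_vertex j d0).2.
split=> //; rewrite -{1}ysimplex.2.
apply: le_trans (sqr_sum_le_dotvv (S := [set i in s]) _) _ => [i|].
  rewrite inE => si; rewrite yE summxE big1// => k _; have [j sj ->] := hyp k.
  rewrite mxE vertexE (_ : i == j = false) ?mulr0//.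
  by apply: contraNF si => /eqP->.
by rewrite ler_wpM2r ?dotvv_ge0// ler_nat cardsE card_size.
Qed.

Lemma ah_run_vertices d (m : active_hull_method R n) (pick : 'rV[R]_n -> 'I_n) i0 N :
  0 <= d ->
  let y := ah_run m (fun x => vertex d (pick x)) (vertex d i0) N in
  simplex d y /\ d ^+ 2 <= N.+1%:R * dotv y y.
Proof.
move=> d0 /=; rewrite /ah_run; set lmo := fun x => _.
have [s ss sE] : exists2 s, size s = N.+1 &
    ah_iterates m lmo (vertex d i0) N N = [seq vertex d i | i <- s].
  (* The induction varies the length and the step counter only; the total [N] handed to the method
     stays fixed. *)
  elim: {1 3}N => [|k [s ss IH]] /=; first by exists [:: i0].
  by rewrite IH; eexists (rcons s _); [rewrite size_rcons ss|rewrite map_rcons].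
by rewrite -ss; apply: conv_hull_vertices => //; rewrite -sE; apply: ah_output_hull;
   rewrite sE size_map.
Qed.

End ScaledSimplex.

(** * From the gap between two powers to the rate and the call count *)

Section Rate.
Variables (R : realType) (nu : R).
Hypothesis nu_ge0 : 0 <= nu.

Let q : R := (1 + nu) / 2.

(* M / (2 (1 + nu)) is the factor of the objective, 2^(-q) comes from
   d^2 = D^2 / 2, and 1 - 2^(-q) from (N + 1)^(-q) - n^(-q) with n >= 2 (N + 1). *)
Definition lower_const : R :=
  2^-1 `^ ((1 + nu) / 2) * (1 - 2^-1 `^ ((1 + nu) / 2)) / (2 * (1 + nu)).

Let q_gt0 : 0 < q. Proof. by rewrite divr_gt0// ltr_wpDr. Qed.

Lemma lower_const_gt0 : 0 < lower_const.
Proof.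
have : 2^-1 `^ q < 1 `^ q :> R.
  by apply: gt0_ltr_powR; rewrite ?nnegrE ?invr_ge0 ?invf_lt1 ?ltr1n.
by rewrite powR1 => t1;
rewrite /lower_const -/q divr_gt0 ?mulr_gt0 ?subr_gt0 ?powR_gt0 ?invr_gt0 ?ltr_wpDr.
Qed.

(** [N <= K] bounds the first power below and [2 (K + 1) <= n] bounds the second above, both by
    multiples of the same power of [K.+1]. *)
Lemma gap_lower_bound (M D : R) (n N K : nat) :
  0 < M -> 0 < D -> (N <= K)%N -> (K.+1.*2 <= n)%N ->
  lower_const * M * D `^ (1 + nu) * K.+1%:R `^ (- q) <=
  M / (2 * (1 + nu)) * (((D ^+ 2 / 2) / N.+1%:R) `^ q - ((D ^+ 2 / 2) / n%:R) `^ q).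
Proof.
move=> M0 D0 NK Kn.
have n0 : (0 < n)%N by apply: leq_trans Kn; rewrite doubleS.
have Dq : D `^ (1 + nu) = (D ^+ 2) `^ q.
  by rewrite -powR_mulrn ?ltW// -powRrM /q mulrCA divff ?mulr1.
have D2 : 0 <= D ^+ 2 by exact: sqr_ge0.
have i0 (k : nat) : 0 <= k%:R^-1 :> R by rewrite invr_ge0.
have KE : K.+1%:R `^ (- q) = K.+1%:R^-1 `^ q :> R.
  by rewrite -powR_inv1// -powRrM mulN1r.
have le1 : K.+1%:R^-1 `^ q <= N.+1%:R^-1 `^ q :> R.
  apply: ge0_ler_powR; rewrite ?nnegrE ?(ltW q_gt0)//.
  by rewrite lef_pV2 ?posrE ?ltr0n// ler_nat.
have le2 : n%:R^-1 `^ q <= 2^-1 `^ q * K.+1%:R^-1 `^ q :> R.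
  rewrite -powRM//; apply: ge0_ler_powR; rewrite ?nnegrE ?(ltW q_gt0) ?mulr_ge0//.
  by rewrite -invfM lef_pV2 ?posrE ?mulr_gt0 ?ltr0n// -natrM ler_nat mul2n.
rewrite {}Dq KE; move: (D ^+ 2) D2 => E E0; rewrite !powRM ?mulr_ge0//.
rewrite (_ : lower_const * M * _ * _ =
    M / (2 * (1 + nu)) * (E `^ q * 2^-1 `^ q *
      ((1 - 2^-1 `^ q) * K.+1%:R^-1 `^ q))); last by rewrite /lower_const -/q; ring.
rewrite ler_wpM2l// ?divr_ge0 ?mulr_ge0 ?addr_ge0 ?(ltW M0)//.
rewrite -mulrBr ler_wpM2l ?mulr_ge0 ?powR_ge0//.
by rewrite mulrBl mul1r lerB.
Qed.

(** The hypothesis is solved for [k.+1] by raising it to the power [1 / q = 2 / (1 + nu)]. *)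
Lemma call_count_bound (c D eps : R) (k : nat) :
  0 < c -> 0 < D -> 0 < eps -> c * D `^ (1 + nu) * k.+1%:R `^ (- q) < eps ->
  c `^ (2 / (1 + nu)) * D ^+ 2 * eps `^ (- (2 / (1 + nu))) <= k.+1%:R.
Proof.
move=> c0 D0 eps0.
have qE : 2 / (1 + nu) = q^-1 by rewrite /q invf_div.
have q0 : q != 0 by rewrite gt_eqF.
rewrite !powRN ltr_pdivrMr ?powR_gt0// qE => lt_eps.
rewrite ler_pdivrMr ?powR_gt0//.
have powV x : 0 <= x -> (x `^ q) `^ q^-1 = x.
  by move=> x0; rewrite -powRrM divff// powRr1.
have c0' := ltW c0; have eps0' := ltW eps0.
have D2 : (D `^ (1 + nu)) `^ q^-1 = D ^+ 2.
  rewrite -powRrM -powR_mulrn ?(ltW D0)//; congr (_ `^ _).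
  by rewrite -qE mulrCA divff ?mulr1// gt_eqF// ltr_wpDr.
have rhsE : (eps * k.+1%:R `^ q) `^ q^-1 = k.+1%:R * eps `^ q^-1.
  by rewrite powRM ?powR_ge0// powV// mulrC.
rewrite -rhsE -D2 -(powRM _ c0' (powR_ge0 D _)).
apply: ge0_ler_powR; rewrite ?nnegrE ?invr_ge0 ?(ltW q_gt0)//.
- by rewrite mulr_ge0 ?powR_ge0.
- by rewrite mulr_ge0 ?powR_ge0.
- exact: ltW.
Qed.

End Rate.

Theorem theorem2p1 (R : realType) (nu : R) (nu_ge0 : 0 <= nu) (nu_le1 : nu <= 1) :
  exists C : R, 0 < C /\
  forall (M D : R) (n : nat), 0 < M -> 0 < D -> (4 <= n)%N ->
  exists (Y : set 'rV[R]_n) (f : 'rV[R]_n -> R) (pstar : R)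
         (lmo : 'rV[R]_n -> 'rV[R]_n) (y0 : 'rV[R]_n),
    [/\ Y !=set0, convex_set Y, compact Y & diameter Y = D] /\
    [/\ convex_function setT f, holder_smooth M nu f & is_min_value Y f pstar] /\
    [/\ is_lmo Y lmo & Y y0] /\
    (forall (m : active_hull_method R n) (K N : nat),
       (1 <= K <= n./2 - 1)%N -> (1 <= N <= K)%N ->
       C * M * D `^ (1 + nu) * K.+1%:R `^ (- ((1 + nu) / 2)) <=
       f (ah_run m lmo y0 N) - pstar) /\
    (forall (m : active_hull_method R n) (eps : R) (N : nat),
       0 < eps -> (1 <= N)%N ->
       eps_optimal Y f pstar eps (ah_run m lmo y0 N) ->
       Num.ceil (Num.min (n./2)%:R
         (C `^ (2 / (1 + nu)) * M `^ (2 / (1 + nu)) * D ^+ 2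
            * eps `^ (- (2 / (1 + nu))))) - 1 <= N%:Z).
Proof.
exists (lower_const nu); split; first exact: lower_const_gt0.
(* From here on the dimension is [n.+1], so that [ord0] exists. *)
move=> M D [//|n] M0 D0 n4.
set d := D / Num.sqrt 2; set c := M / (2 * (1 + nu)).
have s2 : 0 < Num.sqrt 2 :> R by rewrite sqrtr_gt0.
have d0 : 0 <= d by rewrite divr_ge0 ?ltW.
have d2 : d ^+ 2 = D ^+ 2 / 2 by rewrite exprMn exprVn sqr_sqrtr.
have c0 : 0 <= c by rewrite divr_ge0 ?mulr_ge0 ?addr_ge0 ?(ltW M0).
have q0 : 0 <= (1 + nu) / 2 by rewrite divr_ge0 ?addr_ge0.
pose f (x : 'rV[R]_n.+1) := c * enorm x `^ (1 + nu).
pose pick (l : 'rV[R]_n.+1) := [arg min_(i < ord0) l ord0 i]%O.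
(* The objective at squared norm [d^2 / k]: the minimum when [k] is the dimension, a lower bound on
   the output when [k = N.+1]. *)
pose value (k : nat) := c * ((D ^+ 2 / 2) / k%:R) `^ ((1 + nu) / 2).
have value_le (k : nat) y : (0 < k)%N -> d ^+ 2 <= k%:R * dotv y y ->
    value k <= f y.
  move=> k0 dy; rewrite /value /f ler_wpM2l// enorm_powR.
  apply: ge0_ler_powR => //; rewrite ?nnegrE ?dotvv_ge0//.
    by rewrite !divr_ge0 ?sqr_ge0.
  by rewrite ler_pdivrMr ?ltr0n// -d2 mulrC.
have half_gt0 : (1 <= n.+1./2)%N by rewrite geq_half_double (leq_trans _ n4).
exists (simplex d), f, (value n.+1), (fun l => vertex d (pick l)), (vertex d ord0).
have gap (m : active_hull_method R n.+1) (K N : nat) :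
    (1 <= K <= n.+1./2 - 1)%N -> (1 <= N <= K)%N ->
    lower_const nu * M * D `^ (1 + nu) * K.+1%:R `^ (- ((1 + nu) / 2)) <=
    f (ah_run m (fun l => vertex d (pick l)) (vertex d ord0) N) - value n.+1.
  move=> /andP[_ Kn] /andP[_ NK].
  have [_ run_ge] := ah_run_vertices m pick ord0 N d0.
  apply: (@le_trans _ _ (value N.+1 - value n.+1)); last by rewrite lerB// value_le.
  rewrite -mulrBr; apply: gap_lower_bound => //.
  (* [half_gt0] makes the truncated subtraction exact, so the bound on [K] becomes
     [K.+1.*2 <= n.+1]. *)
  by rewrite -geq_half_double -addn1 -(subnK half_gt0) leq_add2r.
split.
  split.
  - by exists (vertex d ord0); exact: simplex_vertex.
  - exact: convex_simplex.
  - exact: compact_simplex.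
  - have i01 : ord0 != ord_max :> 'I_n.+1 by rewrite -val_eqE/=; case: (n) n4.
    by rewrite (diameter_simplex d0 i01) /d mulrC divfK// gt_eqF.
split.
  split.
  - move=> t x y xT yT; have := convex_enorm_powR (_ : 1 <= 1 + nu) t xT yT.
    rewrite lerDl => /(_ nu_ge0)/(ler_wpM2l c0)/le_trans; apply.
    by rewrite !convRE mulrDr !(mulrCA c).
  - exact: holder_smooth_enorm_powR (ltW M0).
  - split=> [|y yd]; last first.
      (* Cauchy-Schwarz with full support; the barycenter below gives equality. *)
      apply: value_le => //; rewrite -yd.2.
      have := @sqr_sum_le_dotvv _ _ [set: 'I_n.+1] y.
      by rewrite cardsT card_ord; apply=> i; rewrite inE.
    exists (const_mx (d / n.+1%:R)).
      split=> [i|]; first by rewrite mxE divr_ge0.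
      under eq_bigr => i _ do rewrite mxE.
      by rewrite sumr_const card_ord -[LHS]mulr_natr divfK ?pnatr_eq0.
    rewrite /f enorm_powR /value -d2; congr (_ * _ `^ _).
    rewrite /dotv; under eq_bigr => i _ do rewrite mxE.
    by rewrite sumr_const card_ord -[LHS]mulr_natr -mulrA divfK ?pnatr_eq0// mulrAC.
split.
  split=> [l|]; last exact: simplex_vertex.
  split=> [|y yd]; first exact: simplex_vertex.
  (* The mass [d] is split into the coordinates of [y], each weighting an entry of [l] no smaller
     than the picked one. *)
  rewrite dotv_vertex -yd.2 mulr_suml; apply: ler_sum => i _.
  rewrite mulrC ler_wpM2r ?yd.1// /pick.
  by case: arg_minP => // j _ ->.
split=> // m eps N eps0 N1 [_ opt].
(* [Num.ceil x - 1 <= N] amounts to [x <= N + 1]. *)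
rewrite lerBlDr ceil_le_int.
have -> : (N%:Z + 1)%:~R = N.+1%:R :> R by rewrite addrC -intS.
(* If half the dimension is at most [N.+1], the first entry of the minimum suffices; otherwise [gap]
   applies with [K = N]. *)
rewrite ge_min; have [nN|Nn] := leqP n.+1./2 N.+1; first by rewrite ler_nat nN.
apply/orP; right.
have KN : (1 <= N <= n.+1./2 - 1)%N.
  by rewrite N1 -(leq_add2r 1) subnK// addn1 ltnW.
have := gap m N N KN; rewrite N1 leqnn => /(_ isT)/le_lt_trans/(_ opt).
have C0 := lower_const_gt0 nu_ge0.
rewrite -(powRM _ (ltW C0) (ltW M0)).
exact: call_count_bound (mulr_gt0 C0 M0) D0 eps0.
Qed.
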